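(* For all integers $k\geq 0$ and all primes $p\geq 3$, $$e_k\left(\frac{p}{1},\ldots,\frac{p}{p-1}\right)+\sum_{j\geq k}(-1)^{j+1}\binom{j}{k}e_j\left(\frac{p}{1},\ldots,\frac{p}{p-1}\right)=0.$$
   Context: $e_j$ denotes the $j$-th elementary symmetric function, here evaluated at the $p-1$ rational numbers $p/i$, $i=1,\ldots,p-1$; $e_0=1$, and $e_j$ of $p-1$ arguments is $0$ for $j\geq p$, so the sum is finite. *)

(* Defs.v *)
From mathcomp Require Import all_boot all_order all_algebra.
From mathcomp.multinomials Require Import mpoly.
Set Implicit Arguments.
Unset Strict Implicit.
Unset Printing Implicit Defensive.
Import GRing.Theory.
Local Open Scope ring_scope.

(* The index i : 'I_(p.-1) is 0-based, hence the denominators i.+1 = 1, ..., p-1. *)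
Definition p_over (p : nat) (i : 'I_p.-1) : rat := p%:R / i.+1%:R.

Definition elem_p_over (p j : nat) : rat := (mesym p.-1 rat j).@[@p_over p].

(* A sum over all j >= k of terms containing e_j may be truncated to j < p. *)
Lemma elem_p_over_geq (p j : nat) : (0 < p)%N -> (p <= j)%N -> elem_p_over p j = 0.
Proof.
move=> p_gt0 le_pj; rewrite /elem_p_over mesym_geqnE ?meval0 //.
by rewrite prednK.
Qed.

(* Main.v *)
Require Import Defs.
From mathcomp Require Import all_boot all_order all_algebra.
From mathcomp.multinomials Require Import mpoly.
Import GRing.Theory.
Local Open Scope ring_scope.

(** The polynomial P(X) = \prod_(1 <= i < p) (1 + (p/i) X) has e_k(p/1, ...,
    p/(p-1)) as its coefficient of X^k.  Since 1 - (p/i)(1 + X) equals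
    - ((p-i)/i) (1 + (p/(p-i)) X), exchanging i and p - i gives
    P(- 1 - X) = (- 1)^(p-1) P(X) = P(X) for p odd; the theorem compares
    the coefficients of X^k on both sides. *)

(** Expanding the product chooses [v i *: 'X] on a set [J] of indices and 1 elsewhere; the sets with
    #|J| = j contribute to the coefficient of X^j. *)
Lemma prod_1DZX_mesym (R : comNzRingType) (n : nat) (v : 'I_n -> R) :
  \prod_(i < n) (1 + v i *: 'X) =
  \sum_(j < n.+1) (mesym n R j).@[v] *: 'X^j :> {poly R}.
Proof.
have card_le (J : {set 'I_n}) : (#|J| < n.+1)%N.
  by rewrite ltnS (leq_trans (max_card _)) ?card_ord.
under eq_bigr do rewrite addrC.
rewrite bigA_distr.
rewrite (partition_big (fun J : {set 'I_n} => Ordinal (card_le J)) predT) //=.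
apply: eq_bigr => j _; rewrite /mesym raddf_sum /= scaler_suml.
apply: eq_big => // J /eqP <- /=.
rewrite -big_mkcond /= scaler_prod prodr_const rmorph_prod /=.
by congr (_ *: _); apply: eq_bigr => i _; rewrite mevalXU.
Qed.

Lemma coef_1DXn (R : comNzRingType) (n k : nat) :
  ((1 + 'X) ^+ n : {poly R})`_k = 'C(n, k)%:R.
Proof.
rewrite exprDn (_ : \sum_(i < n.+1) _ = \poly_(i < n.+1) 'C(n, i)%:R); last first.
  by rewrite poly_def; apply: eq_bigr => i _; rewrite expr1n mul1r scaler_nat.
by rewrite coef_poly ltnS; case: leqP => // /bin_small ->.
Qed.

(** Composition sends X^j to (-1)^j (1 + X)^j, and the terms with j < k drop out because their
    binomial coefficient is 0. *)
Lemma coef_comp_N1BX (R : comNzRingType) (n k : nat) (a : nat -> R) :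
  ((\sum_(j < n) a j *: 'X^j) \Po (- 1 - 'X))`_k =
  \sum_(k <= j < n) (-1) ^+ j * ('C(j, k))%:R * a j.
Proof.
rewrite raddf_sum coef_sum big_geq_mkord [RHS]big_mkcond /=.
apply: eq_bigr => j _.
rewrite comp_polyZ rmorphXn /= comp_polyX -opprD (exprNn (1 + 'X)) coefZ.
rewrite (_ : (-1) ^+ j = ((-1) ^+ j)%:P :> {poly R}); last first.
  by rewrite rmorphXn /= rmorphN1.
rewrite coefCM coef_1DXn.
case: leqP => [_|/bin_small ->]; last by rewrite !mulr0.
by rewrite mulrC.
Qed.

Lemma prod_p_over_comp (p : nat) : odd p ->
  (\prod_(i < p.-1) (1 + p_over i *: 'X)) \Po (- 1 - 'X) =
  \prod_(i < p.-1) (1 + @p_over p i *: 'X).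
Proof.
case: p => // n /[!oddS] even_n; rewrite [n.+1.-1]/=.
(* With p = n + 1 and the 0-based [i] standing for the denominator i + 1, [(rev_ord i).+1] is p - (i
   + 1), so [c i] is the factor -(p - i)/i of the overview. *)
pose c (i : 'I_n) : rat := - ((rev_ord i).+1%:R / i.+1%:R).
(* The n signs cancel since n is even, and the numerators are the denominators in reverse order. *)
have prod_c : \prod_(i < n) c i = 1.
  rewrite prodrN card_ord -signr_odd (negbTE even_n) mul1r prodf_div.
  have -> : \prod_(i < n) (rev_ord i).+1%:R = \prod_(i < n) i.+1%:R :> rat.
    by rewrite [RHS](reindex_inj rev_ord_inj).
  by rewrite divff //; apply/prodf_neq0 => i _; rewrite Num.Theory.pnatr_eq0.
rewrite rmorph_prod /= [RHS](reindex_inj rev_ord_inj) /=.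
(* Spreading 1 as the product of the [c i] over the reversed right-hand side makes the two products
   agree factor by factor. *)
rewrite -[RHS]scale1r -prod_c -scaler_prod.
apply: eq_bigr => i _.
have rev_i : (rev_ord i).+1%:R = n.+1%:R - i.+1%:R :> rat.
  by rewrite -natrB ?subSn // ltnS ltnW.
have i_neq0 : i.+1%:R != 0 :> rat by rewrite Num.Theory.pnatr_eq0.
have ri_neq0 : (rev_ord i).+1%:R != 0 :> rat by rewrite Num.Theory.pnatr_eq0.
have c_const : c i = 1 - @p_over n.+1 i.
  by rewrite /c /p_over rev_i mulrBl divff // opprB.
have c_lin : c i * @p_over n.+1 (rev_ord i) = - @p_over n.+1 i.
  by rewrite /c /p_over mulNr mulrC mulrA divfK.
rewrite rmorphD rmorph1 /= comp_polyZ comp_polyX [RHS]scalerDr scalerA c_lin c_const.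
by rewrite scalerBl scale1r scalerBr scalerN scaleNr addrA.
Qed.

Theorem proposition3p1 (k p : nat) (p_prime : prime p) (p_ge3 : (3 <= p)%N) :
  elem_p_over p k
    + \sum_(k <= j < p) (-1) ^+ j.+1 * ('C(j, k))%:R * elem_p_over p j = 0 :> rat.
Proof.
have p_gt0 := prime_gt0 p_prime.
have p_odd : odd p by case: (even_prime p_prime) p_ge3 => // ->.
have := congr1 (fun P : {poly rat} => P`_k) (prod_p_over_comp p p_odd).
rewrite /= prod_1DZX_mesym prednK //.
rewrite (coef_comp_N1BX _ _ _ (elem_p_over p)) => sum_eq.
(* This also covers k >= p, where both sides are 0. *)
have -> : elem_p_over p k = (\sum_(j < p) elem_p_over p j *: 'X^j)`_k.
  rewrite -poly_def coef_poly.
  by case: ltnP => // le_pk; rewrite elem_p_over_geq.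
(* The first term becomes the same sum with (-1)^j in place of (-1)^(j+1), so the two cancel
   termwise. *)
rewrite -[X in X + _]sum_eq -big_split /= big1 // => j _.
by rewrite exprS !mulN1r !mulNr subrr.
Qed.
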